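(* Let $q\ge3$ be an integer, $B=0$, and assume that $\mathbb{E}[W^3]<\infty$. For $\beta>0$ let $s^\star(\beta,0)$ be the optimal value, i.e. a maximizer over $s\in[0,1]$ of $$p_{\beta,0}(s)=\mathbb{E}\big[\log(\mathrm{e}^{\beta'Ws}+q-1)\big]-\frac{\beta'\mathbb{E}[W]}{2q}\big[(q-1)s^2+2s-1\big],\qquad\beta'=\mathrm{e}^\beta-1.$$ Then there exists a critical value $\beta_c(0)\in(0,\infty)$ such that $\beta\mapsto s^\star(\beta,0)$ makes a jump at $\beta_c(0)$; thus the annealed Potts model has a first-order phase transition at $\beta_c(0)$. Further, $s^\star(\beta,0)=0$ for $\beta\in(0,\beta_c(0))$ and $s^\star(\beta,0)>0$ for all $\beta>\beta_c(0)$.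
   Context: $W$ is a non-negative random variable with $\mathbb{E}[W]>0$ such that, for some $c>0$ and $\tau>2$, $\mathbb{P}(W>w)\le c\,w^{-(\tau-1)}$ for all $w\ge1$; it is the limiting weight of a rank-1 inhomogeneous random graph, and $\sup_{s\in[0,1]}p_{\beta,0}(s)$ is the limiting annealed pressure per particle of the $q$-state Potts model on it with zero field. ''Makes a jump at $\beta_c(0)$'' means that $s^\star(\beta,0)$ is discontinuous there: it vanishes for $\beta<\beta_c(0)$ and does not tend to $0$ (stays bounded away from $0$) as $\beta\searrow\beta_c(0)$. The maximizer need not be unique for each $\beta$; the statement concerns any choice of maximizer. *)

(* Defs.v *)
From HB Require Import structures.
From mathcomp Require Import all_boot all_order all_algebra.
From mathcomp Require Import all_classical all_reals all_analysis.

Set Implicit Arguments.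
Unset Strict Implicit.
Unset Printing Implicit Defensive.

Import Order.TTheory GRing.Theory Num.Theory.
Import numFieldNormedType.Exports.

Local Open Scope classical_set_scope.
Local Open Scope ring_scope.

(* p_{beta,0}(s), with beta' = e^beta - 1.  The library expectation is
   extended-real valued; for beta, s >= 0, [fine] is harmless as soon as W is
   nonnegative a.s. and integrable, since 0 <= log (e^x + q - 1) <= x + log q
   for x >= 0 and q >= 1. *)
Definition pressure_functional d (T : measurableType d) (R : realType)
    (P : probability T R) (W : {RV P >-> R}) (q : nat) (beta s : R) : R :=
  let beta' := expR beta - 1 in
  fine 'E_P[fun x => ln (expR (beta' * W x * s) + q%:R - 1)]
  - beta' * fine 'E_P[W] / (2 * q%:R)
    * ((q%:R - 1) * s ^+ 2 + 2 * s - 1).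

Definition is_maximizer_on (R : realType) (A : set R) (f : R -> R) (s : R) : Prop :=
  A s /\ forall t, A t -> f t <= f s.

(* Only the values of f on (0, +oo) matter (b is positive in the application);
   the value f b itself is left free. *)
Definition makes_jump_at (R : realType) (f : R -> R) (b : R) : Prop :=
  [/\ ~ {for b, continuous f},
      forall beta, 0 < beta < b -> f beta = 0
    & exists2 delta : R, 0 < delta & \forall beta \near b^'+, delta <= f beta].

(* Main.v *)
Require Import Defs.
From HB Require Import structures.
From mathcomp Require Import all_boot all_order all_algebra.
From mathcomp Require Import all_classical all_reals all_analysis.
From mathcomp Require Import measurable_realfun ring lra.

Set Implicit Arguments.
Unset Strict Implicit.
Unset Printing Implicit Defensive.

Import Order.TTheory GRing.Theory Num.Theory.
Import numFieldNormedType.Exports.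

Local Open Scope classical_set_scope.
Local Open Scope ring_scope.

(** Put b = e^beta - 1, m = E[W] and g(x) = log((e^x + q - 1) / q) - x / q,
    a nonnegative convex function with g(0) = 0.  Up to a term independent of s,
    the pressure is
      F(b, s) = E[g(b s W)] - b m (q - 1) / (2 q) s^2.
    Strict convexity gives F(lam b, s) > lam F(b, s) for lam > 1, so the set of b
    at which F(b, .) takes a positive value is an up-set; its infimum b_c is the
    critical point, and below it 0 is the only maximizer.  The third derivative
    of g at 0 is positive because q > 2, so (the third moment being finite) at
    the value of b where the s^2-coefficient of F(b, .) vanishes, F is still
    positive for some small s.  Hence that value is strictly above b_c, the
    s^2-coefficient is negative near b_c, and positive maximizers there stay
    away from 0. *)

(** * Sign of a function from the sign of its derivative *)

Lemma is_derive_mean_value (R : realType) (f df : R -> R) (a b : R) :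
  (forall x : R, is_derive x 1 f (df x)) -> a < b ->
  exists2 c, a < c < b & f b - f a = df c * (b - a).
Proof.
move=> f_df ab; have [|c cab ->] := MVT ab (fun x _ => f_df x).
  by apply: derivable_within_continuous => x _; apply: ex_derive.
by exists c => //; move: cab; rewrite in_itv/=.
Qed.

Lemma is_derive_ge0 (R : realType) (f df : R -> R) (X : R) :
  (forall x : R, is_derive x 1 f (df x)) -> f 0 = 0 ->
  (forall x, 0 <= x <= X -> 0 <= df x) -> forall x, 0 <= x <= X -> 0 <= f x.
Proof.
move=> f_df f0 df_ge0 x /andP[]; rewrite le_eqVlt => /predU1P[<-|x0] xX.
  by rewrite f0.
have [c /andP[c0 cx]] := is_derive_mean_value f_df x0.
rewrite f0 !subr0 => ->; rewrite mulr_ge0 ?(ltW x0)// df_ge0//.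
by rewrite (ltW c0)/= (le_trans (ltW cx)).
Qed.

Lemma is_derive_gt0 (R : realType) (f df : R -> R) :
  (forall x : R, is_derive x 1 f (df x)) -> f 0 = 0 ->
  (forall x, 0 < x -> 0 < df x) -> forall x, 0 < x -> 0 < f x.
Proof.
move=> f_df f0 df_gt0 x x0.
have [c /andP[c0 _]] := is_derive_mean_value f_df x0.
by rewrite f0 !subr0 => ->; rewrite mulr_gt0// df_gt0.
Qed.

(** * Calculus of the log-sum-exp function and its cubic bounds near 0 *)

Section logsumexp.
Variables (R : realType) (q : R).
Hypothesis q_gt1 : 1 < q.

(** The derivative [expR x / (expR x + (q - 1))] of [ln (expR x + (q - 1))], in a form where only
    one inverse has to be differentiated. *)
Definition logistic (x : R) := 1 - (q - 1) * (expR x + (q - 1))^-1.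

(** The g of the overview: [ln (expR x + (q - 1))] minus its tangent at 0, which has value [ln q]
    and slope [q^-1]. *)
Definition excess_lse (x : R) := ln (expR x + (q - 1)) - ln q - q^-1 * x.

Let den_gt0 (x : R) : 0 < expR x + (q - 1).
Proof. have q1 := q_gt1; by have := expR_gt0 x; lra. Qed.

Lemma logistic0 : logistic 0 = q^-1.
Proof. have q1 := q_gt1; by rewrite /logistic expR0; field; lra. Qed.

Lemma logistic_gt0 x : 0 < logistic x.
Proof.
have -> : logistic x = expR x / (expR x + (q - 1)).
  by rewrite /logistic; field; rewrite gt_eqF.
by rewrite divr_gt0 ?expR_gt0.
Qed.

Lemma logistic_lt1 x : logistic x < 1.
Proof.
have q1 := q_gt1.
by rewrite /logistic ltrBlDr ltrDl mulr_gt0 ?invr_gt0//; lra.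
Qed.

Lemma excess_lse0 : excess_lse 0 = 0.
Proof.
by rewrite /excess_lse expR0 addrCA subrr addr0 subrr mulr0 subrr.
Qed.

Local Instance is_derive_den (x : R) :
  is_derive x 1 (fun y : R => expR y + (q - 1)) (expR x).
Proof.
have -> : (fun y => expR y + (q - 1)) = expR + cst (q - 1) by [].
by apply: is_derive_eq; rewrite addr0.
Qed.

(** The logistic equation s' = s (1 - s) makes the higher derivatives of [excess_lse] polynomials in
    [logistic]. *)
Local Instance is_derive_logistic (x : R) :
  is_derive x 1 logistic (logistic x * (1 - logistic x)).
Proof.
have d0 := den_gt0 x.
have dV := @is_deriveV R _ x (expR x) 1 (lt0r_neq0 d0) (is_derive_den x).
suff : is_derive x 1 (cst 1 - (q - 1) \*: (fun y => (expR y + (q - 1))^-1))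
  (logistic x * (1 - logistic x)) by [].
apply: is_derive_eq; rewrite /GRing.scale/= /logistic.
by field; rewrite gt_eqF.
Qed.

Local Instance is_derive_excess_lse (x : R) :
  is_derive x 1 excess_lse (logistic x - q^-1).
Proof.
have q1 := q_gt1.
have d0 := den_gt0 x.
have dl := @is_derive1_comp R (@ln R) (fun y => expR y + (q - 1)) _ _ _
  (is_derive1_ln d0) (is_derive_den x).
have -> : excess_lse = (@ln R \o (fun y => expR y + (q - 1))) - cst (ln q)
    - q^-1 \*: id by [].
apply: is_derive_eq; rewrite /= /logistic /GRing.scale/=.
by field; rewrite gt_eqF//=; lra.
Qed.

Lemma logistic_ltr x y : x < y -> logistic x < logistic y.
Proof.
move=> xy; have [c _] := is_derive_mean_value is_derive_logistic xy.
rewrite -subr_gt0 => ->; rewrite !mulr_gt0 ?logistic_gt0 ?subr_gt0//.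
exact: logistic_lt1.
Qed.

Lemma excess_lse_ge0 x : 0 <= x -> 0 <= excess_lse x.
Proof.
move=> x0; apply: (is_derive_ge0 is_derive_excess_lse excess_lse0 (X := x)).
  move=> y /andP[y0 _]; rewrite -logistic0 subr_ge0.
  by move: y0; rewrite le_eqVlt => /predU1P[<-//|/logistic_ltr/ltW].
by rewrite x0/=.
Qed.

(** The slope [logistic - q^-1] is below 1. This serves for integrability and, in [gap_lip], for the
    dependence on b. *)
Lemma excess_lse_lip x y : x <= y -> excess_lse y - excess_lse x <= y - x.
Proof.
have q1 := q_gt1.
rewrite le_eqVlt => /predU1P[->|xy]; first by rewrite !subrr.
have [c _ ->] := is_derive_mean_value is_derive_excess_lse xy.
rewrite ler_piMl ?subr_ge0 ?(ltW xy)//.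
have := logistic_lt1 c; have : 0 < q^-1 by rewrite invr_gt0; lra.
lra.
Qed.

(** The difference of the two sides vanishes at 0, and its derivative is positive because [logistic]
    is increasing. *)
Lemma excess_lse_superhom lam x : 1 < lam -> 0 < x ->
  lam * excess_lse x < excess_lse (lam * x).
Proof.
move=> lam1 x0; rewrite -subr_gt0.
pose f (y : R) := excess_lse (lam * y) - lam * excess_lse y.
apply: (@is_derive_gt0 _ f
  (fun y => lam * (logistic (lam * y) - logistic y))) => //.
- move=> y; have dl : is_derive y 1 (fun y : R => lam * y) lam.
    have -> : (fun y : R => lam * y) = lam \*: id by [].
    by apply: is_derive_eq; rewrite /GRing.scale/= mulr1.
  have dc := is_derive1_comp (is_derive_excess_lse (lam * y)) dl.
  have -> : f = (excess_lse \o (fun y : R => lam * y)) - lam \*: excess_lse.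
    by [].
  by apply: is_derive_eq; rewrite /GRing.scale/=; ring.
- by rewrite /f mulr0 excess_lse0 mulr0 subrr.
- move=> y y0; rewrite mulr_gt0//; first lra.
  by rewrite subr_gt0 logistic_ltr// ltr_pMl.
Qed.

(** Taylor remainder at 0 with the exact quadratic part and a trial value [k] of the third
    derivative. *)
Let remainder (k x : R) :=
  excess_lse x - (q^-1 * (1 - q^-1) / 2 * x ^+ 2 + k / 6 * x ^+ 3).

(** The remainder and its first two derivatives vanish at 0, so three integrations transport the
    sign of the third derivative. Taking [e] to be 1 or -1 yields lower and upper bounds from one
    proof. *)
Let remainder_ge0 (e k X : R) :
  (forall x, 0 <= x <= X ->
     0 <= e * (logistic x * (1 - logistic x) * (1 - logistic x *+ 2) - k)) ->
  forall x, 0 <= x <= X -> 0 <= e * remainder k x.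
Proof.
have q1 := q_gt1.
move=> H3.
pose a := q^-1 * (1 - q^-1).
pose r2 x := e * (logistic x * (1 - logistic x) - (a + k * x)).
pose r1 x := e * (logistic x - q^-1 - (a * x + k / 2 * x ^+ 2)).
have d2 (x : R) : is_derive x 1 r2
    (e * (logistic x * (1 - logistic x) * (1 - logistic x *+ 2) - k)).
  have -> : r2 = e \*: (logistic * (cst 1 - logistic) - (cst a + k \*: id)).
    by [].
  by apply: is_derive_eq; rewrite /GRing.scale/= !fctE; ring.
have d1 (x : R) : is_derive x 1 r1 (r2 x).
  have -> : r1 = e \*: (logistic - cst q^-1 -
      (a \*: id + (k / 2) \*: (id ^+ 2))).
    by [].
  by apply: is_derive_eq; rewrite /GRing.scale/= /r2; field.
have d0 (x : R) : is_derive x 1 (fun x => e * remainder k x) (r1 x).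
  have -> : (fun x => e * remainder k x) =
    e \*: (excess_lse - ((a / 2) \*: (id ^+ 2) + (k / 6) \*: (id ^+ 3))) by [].
  by apply: is_derive_eq; rewrite /GRing.scale/= /r1; field; lra.
apply: (is_derive_ge0 d0).
  by rewrite /remainder excess_lse0; ring.
apply: (is_derive_ge0 d1); first by rewrite /r1 logistic0; ring.
by apply: (is_derive_ge0 d2) => //; rewrite /r2 logistic0 /a; ring.
Qed.

(** Take [k = 1]: s (1 - s) (1 - 2 s) is at most 1 for s in (0, 1). The resulting factor 1/6 is
    relaxed to 1. *)
Lemma excess_lse_le_cubic x : 0 <= x ->
  excess_lse x <= q^-1 * (1 - q^-1) / 2 * x ^+ 2 + x ^+ 3.
Proof.
move=> x0.
have := @remainder_ge0 (-1) 1 x _ x; rewrite x0 lexx /remainder => r.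
have {}r := r _ isT.
have x3 : 0 <= x ^+ 3 by rewrite exprn_ge0.
suff : 0 <= -1 * (excess_lse x
   - (q^-1 * (1 - q^-1) / 2 * x ^+ 2 + 1 / 6 * x ^+ 3)) by lra.
apply: r => y _.
have := logistic_gt0 y; have := logistic_lt1 y.
by set s := logistic y; nra.
Qed.

(** Take [k = q^-1 / 12]; division by 3! gives the 72. As q >= 3, [logistic] starts at q^-1 <= 1/3
    and grows by at most 1/12, so the third derivative stays above [k]. *)
Lemma excess_lse_ge_cubic x : 3 <= q -> 0 <= x <= 12^-1 ->
  q^-1 * (1 - q^-1) / 2 * x ^+ 2 + (72 * q)^-1 * x ^+ 3 <= excess_lse x.
Proof.
move=> q3 /andP[x0 xX].
have qV : 0 < q^-1 by rewrite invr_gt0; lra.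
have qV3 : q^-1 <= 3^-1 by rewrite lef_pV2 ?posrE//; lra.
have := @remainder_ge0 1 (q^-1 / 12) x _ x; rewrite x0 lexx /remainder => r.
have {}r := r _ isT; rewrite -subr_ge0.
have -> : (72 * q)^-1 = q^-1 / 12 / 6 by field; lra.
rewrite -[leRHS]mul1r; apply: r => y /andP[]; rewrite le_eqVlt => /predU1P[<- _|y0 yx].
  by rewrite logistic0; nra.
have s_gt : q^-1 < logistic y by rewrite -logistic0 logistic_ltr.
have s_lt : logistic y - q^-1 <= y.
  have [c _] := is_derive_mean_value is_derive_logistic y0.
  rewrite logistic0 !subr0 => ->; rewrite ler_piMl ?(ltW y0)//.
  by have := logistic_gt0 c; have := logistic_lt1 c; nra.
(* The bound [x <= 12^-1] serves to keep [1 - 2 logistic] away from 0. *)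
have s5 : logistic y <= 5 / 12 by lra.
have -> : 1 * (logistic y * (1 - logistic y) * (1 - logistic y *+ 2)
    - q^-1 / 12)
  = (logistic y - q^-1) / 12 +
    logistic y * ((1 - logistic y) * (1 - logistic y *+ 2) - 1 / 12).
  by field; lra.
by rewrite addr_ge0// ?mulr_ge0//; [lra|lra|nra].
Qed.

End logsumexp.

(** * Expectations of functions of a nonnegative variable with finite third moment *)

Section moments.
Context d (T : measurableType d) (R : realType) (P : probability T R).
Variable U : T -> R.
Hypotheses (mU : measurable_fun setT U) (U_ge0 : forall x, 0 <= U x).
Hypothesis iU3 : P.-integrable setT (EFin \o (fun x => U x ^+ 3)).

Definition mean (f : R -> R) : R := \int[P]_x f (U x).

(** A class of integrands closed under linear combinations; the bound is asked only for u >= 0,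
    where U takes its values. *)
Definition cubic_growth (f : R -> R) := measurable_fun setT f /\
  exists K, forall u, 0 <= u -> `|f u| <= K * (1 + u ^+ 3).

Lemma cubic_growth_integrable f : cubic_growth f ->
  P.-integrable setT (EFin \o (f \o U)).
Proof.
move=> [mf [K fK]].
have i1 : P.-integrable setT (EFin \o cst (1 : R)).
  exact: finite_measure_integrable_cst.
have iK : P.-integrable setT (EFin \o (fun x => K * (1 + U x ^+ 3))).
  have := integrableZl measurableT K (integrableD measurableT i1 iU3).
  by apply: eq_integrable.
apply: le_integrable iK => //.
  apply/measurable_EFinP; apply: measurableT_comp => //.
move=> x _; rewrite /= lee_fin; apply: le_trans (fK _ (U_ge0 x)) _.
exact: ler_norm.
Qed.

Lemma cubic_growthZ k f : cubic_growth f -> cubic_growth (fun u => k * f u).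
Proof.
move=> [mf [K fK]]; split; first exact: measurable_funM.
exists (`|k| * K) => u u0; rewrite normrM -mulrA ler_wpM2l//; exact: fK.
Qed.

Lemma cubic_growthD f g :
  cubic_growth f -> cubic_growth g -> cubic_growth (fun u => f u + g u).
Proof.
move=> [mf [K fK]] [mg [L gL]]; split; first exact: measurable_funD.
exists (K + L) => u u0; rewrite mulrDl (le_trans (ler_normD _ _))//.
by rewrite lerD ?fK ?gL.
Qed.

Lemma cubic_growthX n : (n <= 3)%N -> cubic_growth (fun u => u ^+ n).
Proof.
move=> n3; split; first exact: measurable_funX.
exists 1 => u u0; rewrite mul1r ger0_norm ?exprn_ge0//.
have [u1|/ltW u1] := leP u 1.
  by rewrite (le_trans (exprn_ile1 _ u0 u1))// lerDl exprn_ge0.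
by rewrite (le_trans (ler_weXn2l u1 n3))// lerDr.
Qed.

Lemma cubic_growth_cst k : cubic_growth (fun=> k).
Proof.
split; first exact: measurable_cst.
exists `|k| => u u0; rewrite ler_peMr// lerDl exprn_ge0//.
Qed.

Lemma meanZ k f : cubic_growth f -> mean (fun u => k * f u) = k * mean f.
Proof.
by move=> gf; apply: RintegralZl => //; exact: cubic_growth_integrable.
Qed.

Lemma meanD f g : cubic_growth f -> cubic_growth g ->
  mean (fun u => f u + g u) = mean f + mean g.
Proof.
by move=> gf gg; apply: RintegralD => //; exact: cubic_growth_integrable.
Qed.

Lemma mean_cst k : mean (fun=> k) = k.
Proof.
by rewrite /mean Rintegral_cst//= [X in fine X](probability_setT P) mulr1.
Qed.

Lemma le_mean f g : cubic_growth f -> cubic_growth g ->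
  (forall u, 0 <= u -> f u <= g u) -> mean f <= mean g.
Proof.
move=> gf gg fg; apply: le_Rintegral => //; try exact: cubic_growth_integrable.
by move=> x _; exact: fg.
Qed.

(** Otherwise f(U) has integral 0, hence vanishes almost everywhere; then so does U, against E[U] >
    0. *)
Lemma mean_gt0 f : cubic_growth f -> (forall u, 0 <= u -> 0 <= f u) ->
  (forall u, 0 < u -> 0 < f u) -> 0 < mean (fun u => u) -> 0 < mean f.
Proof.
move=> gf f_ge0 f_gt0.
have mean_ge0 g : (forall u, 0 <= u -> 0 <= g u) -> 0 <= mean g.
  by move=> g0; apply: Rintegral_ge0 => x _; exact: g0.
apply: contraTT; rewrite -!leNgt => fle0.
have f0 : mean f = 0 by apply/eqP; rewrite eq_le fle0 mean_ge0.
have /ae_eq_integral_abs : (\int[P]_x `|(f (U x))%:E| = 0)%E.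
  rewrite -[RHS]/(0%:E) -f0 /mean /Rintegral fineK; last first.
    by apply: integrable_fin_num => //; exact: cubic_growth_integrable.
  by apply: eq_integral => x _; rewrite gee0_abs// lee_fin f_ge0.
move=> /(_ measurableT) [].
  by apply/measurable_EFinP/measurableT_comp => //; case: gf.
move=> N [mN PN sub].
rewrite /mean /Rintegral (ae_eq_integral (cst 0%E)) ?integral0//.
  exact/measurable_EFinP.
exists N; split => // x /= /not_implyP[_ Ux]; apply: sub => /= H.
apply: Ux; have [fU] := H I.
have := U_ge0 x; rewrite le_eqVlt => /predU1P[<-//|/f_gt0].
by rewrite fU ltxx.
Qed.

Lemma cubic_growth_cut A f : cubic_growth f ->
  cubic_growth (fun u => f u * (A < u)%R%:R).
Proof.
move=> [mf [K fK]]; split.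
  apply: measurable_funM => //.
  have -> : (fun u : R => (A < u)%R%:R) = \1_(`]A, +oo[%classic) :> (R -> R).
    apply/funext => u; rewrite indicE; congr ((nat_of_bool _)%:R).
    by apply/idP/idP; rewrite inE/= in_itv/= andbT.
  exact: measurable_indic.
exists K => u u0; apply: le_trans (fK u u0).
by case: ltP => _; rewrite ?mulr1 ?mulr0 ?normr0.
Qed.

(** Absolute continuity of the integral of U^3, applied to the event U > B. [A] is a prescribed
    floor for the cutoff. *)
Lemma cubic_tail (e A : R) : 0 < e ->
  exists2 B, A <= B & mean (fun u => u ^+ 3 * (B < u)%R%:R) < e.
Proof.
move=> e0.
have [d0 [d0_gt0 small]] := integral_normr_continuous iU3 e0.
have m0 : 0 <= mean (fun u => u) by apply: Rintegral_ge0.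
(* The last term forces E[U] < d0 B, so that Markov's inequality gives P(U > B) < d0. *)
pose B := Num.max A (Num.max 1 (mean (fun u => u) / d0 + 1)).
exists B; first by rewrite le_max lexx.
have B1 : 1 <= B by rewrite !le_max lexx orbT.
have Bm : mean (fun u => u) < d0 * B.
  rewrite mulrC -ltr_pdivrMr//.
  rewrite (@lt_le_trans _ _ (mean (fun u => u) / d0 + 1)) ?ltrDl//.
  by rewrite !le_max lexx !orbT.
pose S := [set x | B < U x].
have mS : measurable S.
  have -> : S = setT `&` U @^-1` `]B, +oo[.
    by rewrite setTI; apply/seteqP; split => x; rewrite /S/= in_itv/= andbT.
  exact: mU.
have PS : (P S < d0%:E)%E.
  rewrite -(fineK (fin_num_measure P S mS)) lte_fin.
  suff : B * fine (P S) <= mean (fun u => u).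
    move=> h; rewrite -(ltr_pM2l (lt_le_trans ltr01 B1)).
    by apply: le_lt_trans h _; rewrite mulrC.
  have -> : fine (P S) = mean (fun u => (B < u)%R%:R).
    rewrite -[S]setIT -integral_indic// /mean /Rintegral; congr fine.
    apply: eq_integral => x _; rewrite indicE /S.
    by congr ((nat_of_bool _)%:R%:E); apply/idP/idP; rewrite inE/=.
  rewrite -meanZ; last first.
    have := cubic_growth_cut B (cubic_growth_cst 1).
    by under eq_fun do rewrite mul1r.
  apply: le_mean => [||u u0].
  - exact: (cubic_growth_cut B (cubic_growth_cst B)).
  - exact: (cubic_growthX (isT : (1 <= 3)%N)).
  - by case: ltP => Bu; rewrite ?mulr1 ?mulr0 ?(ltW Bu).
have -> : mean (fun u => u ^+ 3 * (B < u)%R%:R) = \int[P]_(x in S) `|U x ^+ 3|.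
  rewrite [RHS]Rintegral_mkcond; apply: eq_Rintegral => x _.
  rewrite patchE /S; case: ifPn.
  - by rewrite in_setE/= => ->; rewrite mulr1 ger0_norm// exprn_ge0.
  - by rewrite notin_setE/= => /negP/negbTE ->; rewrite mulr0.
exact: small.
Qed.

Lemma mean_cubic c0 c1 c2 c3 :
  mean (fun u => c0 + c1 * u + c2 * u ^+ 2 + c3 * u ^+ 3) =
  c0 + c1 * mean id + c2 * mean (fun u => u ^+ 2) + c3 * mean (fun u => u ^+ 3).
Proof.
have g n c : (n <= 3)%N -> cubic_growth (fun u => c * u ^+ n).
  by move=> /cubic_growthX; exact: cubic_growthZ.
have g0 := cubic_growth_cst c0.
have g1 : cubic_growth (fun u => c1 * u) := g 1%N c1 isT.
have g2 := g 2 c2 isT; have g3 := g 3 c3 isT; have g01 := cubic_growthD g0 g1.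
rewrite (meanD (cubic_growthD g01 g2) g3) (meanD g01 g2) (meanD g0 g1) mean_cst.
by rewrite !meanZ//; try exact: cubic_growthX; exact: (@cubic_growthX 1).
Qed.

Lemma cubic_growth_cubic c0 c1 c2 c3 :
  cubic_growth (fun u => c0 + c1 * u + c2 * u ^+ 2 + c3 * u ^+ 3).
Proof.
have g n c : (n <= 3)%N -> cubic_growth (fun u => c * u ^+ n).
  by move=> /cubic_growthX; exact: cubic_growthZ.
apply: cubic_growthD (g 3 c3 isT); apply: cubic_growthD (g 2 c2 isT).
exact: cubic_growthD (cubic_growth_cst c0) (g 1%N c1 isT).
Qed.

(** Jensen through the tangent at m. Together with [mean_cube_ge] it makes the higher moments
    positive when the mean is. *)
Lemma mean_sqr_ge : mean id ^+ 2 <= mean (fun u => u ^+ 2).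
Proof.
set m := mean id.
have := le_mean (cubic_growth_cubic (- m ^+ 2) (2 * m) 0 0)
  (@cubic_growthX 2 isT).
rewrite mean_cubic -/m => h.
suff : - m ^+ 2 + 2 * m * m <= mean (fun u => u ^+ 2) by lra.
apply: le_trans (h _); first by rewrite !mul0r !addr0.
move=> u u0; rewrite -subr_ge0.
have -> : u ^+ 2 - (- m ^+ 2 + 2 * m * u + 0 * u ^+ 2 + 0 * u ^+ 3)
  = (u - m) ^+ 2 by ring.
exact: sqr_ge0.
Qed.

Lemma mean_cube_ge : mean id ^+ 3 <= mean (fun u => u ^+ 3).
Proof.
set m := mean id.
have m0 : 0 <= m by apply: Rintegral_ge0.
have := le_mean (cubic_growth_cubic (- 2 * m ^+ 3) (3 * m ^+ 2) 0 0)
  (@cubic_growthX 3 isT).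
rewrite mean_cubic -/m => h.
suff : - 2 * m ^+ 3 + 3 * m ^+ 2 * m <= mean (fun u => u ^+ 3) by lra.
apply: le_trans (h _); first by rewrite !mul0r !addr0.
move=> u u0; rewrite -subr_ge0.
have -> : u ^+ 3 - (-2 * m ^+ 3 + 3 * m ^+ 2 * u + 0 * u ^+ 2 + 0 * u ^+ 3)
  = (u - m) ^+ 2 * (u + 2 * m) by ring.
by rewrite mulr_ge0 ?sqr_ge0//; lra.
Qed.

End moments.

(** * Sign of the s-dependent part of the pressure, and the critical value of b *)

Section gap.
Context d (T : measurableType d) (R : realType) (P : probability T R).
Variable U : T -> R.
Hypotheses (mU : measurable_fun setT U) (U_ge0 : forall x, 0 <= U x).
Hypothesis iU3 : P.-integrable setT (EFin \o (fun x => U x ^+ 3)).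
Variable q : R.
Hypothesis q_ge3 : 3 <= q.
Local Notation E := (mean P U).
Hypothesis m_gt0 : 0 < E id.

Let q_gt1 : 1 < q. Proof. by have q3 := q_ge3; lra. Qed.

(** The F(b, s) of the overview. *)
Definition gap (b s : R) : R :=
  E (fun u => excess_lse q (b * s * u)) - b * E id * (q - 1) / (2 * q) * s ^+ 2.

Lemma measurable_excess_lse : measurable_fun setT (excess_lse q).
Proof.
apply: measurable_funB; last exact: measurable_funM.
apply: measurable_funB => //.
apply: measurableT_comp; first exact: measurable_ln.
by apply: measurable_funD => //; exact: measurable_expR.
Qed.

Lemma cubic_growth_excess_lse t : 0 <= t ->
  cubic_growth (fun u => excess_lse q (t * u)).
Proof.
move=> t0; split.
  apply: measurableT_comp; first exact: measurable_excess_lse.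
  exact: measurable_funM.
exists t => u u0; have tu : 0 <= t * u by rewrite mulr_ge0.
rewrite ger0_norm ?excess_lse_ge0//.
have := excess_lse_lip q_gt1 tu.
rewrite excess_lse0// !subr0 => /le_trans; apply.
rewrite ler_wpM2l//; have [u1|/ltW u1] := leP u 1.
  by rewrite (le_trans u1)// lerDl exprn_ge0.
by rewrite (@le_trans _ _ (u ^+ 3))// ?lerDr// -[leLHS]expr1 ler_weXn2l.
Qed.

(** The quadratic term is linear in b and cancels; what remains is [excess_lse_superhom], strict
    where U > 0. *)
Lemma gap_superhom lam b s : 1 < lam -> 0 < b -> 0 < s ->
  lam * gap b s < gap (lam * b) s.
Proof.
move=> lam1 b0 s0; have bs0 : 0 < b * s by rewrite mulr_gt0.
have g1 := cubic_growth_excess_lse (ltW bs0).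
have g2 : cubic_growth (fun u => excess_lse q (lam * b * s * u)).
  by apply: cubic_growth_excess_lse; rewrite -mulrA mulr_ge0//; lra.
suff : 0 < E (fun u =>
    excess_lse q (lam * b * s * u) + - lam * excess_lse q (b * s * u)).
  rewrite (meanD mU U_ge0 iU3 g2 (cubic_growthZ _ g1)).
  rewrite (meanZ mU U_ge0 iU3 _ g1).
  by rewrite /gap; lra.
have lamE u : lam * b * s * u = lam * (b * s * u) by ring.
apply: (mean_gt0 mU U_ge0 iU3) => //.
- by apply: cubic_growthD => //; exact: cubic_growthZ.
- move=> u; rewrite le_eqVlt => /predU1P[<-|u0].
    by rewrite !mulr0 excess_lse0// mulr0 addr0.
  by rewrite mulNr subr_ge0 lamE ltW// excess_lse_superhom// mulr_gt0.
- by move=> u u0; rewrite mulNr subr_gt0 lamE excess_lse_superhom// mulr_gt0.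
Qed.

Lemma gap_le_cubic b s : 0 < b -> 0 <= s ->
  gap b s <= b * s ^+ 2 * (q^-1 * (1 - q^-1) / 2 * b * E (fun u => u ^+ 2)
    - E id * (q - 1) / (2 * q)) + b ^+ 3 * s ^+ 3 * E (fun u => u ^+ 3).
Proof.
move=> b0 s0; have bs0 : 0 <= b * s by rewrite mulr_ge0// ltW.
have := le_mean mU U_ge0 iU3 (cubic_growth_excess_lse bs0)
  (cubic_growth_cubic 0 0 (q^-1 * (1 - q^-1) / 2 * (b * s) ^+ 2)
    ((b * s) ^+ 3)).
rewrite (mean_cubic mU U_ge0 iU3) => h.
have {}h := h _; rewrite /gap.
apply: le_trans (lerB (h _) (lexx _)) _.
  move=> u u0; have := excess_lse_le_cubic q_gt1 (mulr_ge0 bs0 u0); lra.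
lra.
Qed.

(** Shrinking b also shrinks the subtracted quadratic term, so only the loss in [excess_lse] counts.
    A positive gap thus survives a small decrease of b. *)
Lemma gap_lip lam b s : 0 <= lam <= 1 -> 0 < b -> 0 < s ->
  gap b s - (1 - lam) * (b * s * E id) <= gap (lam * b) s.
Proof.
move=> /andP[lam0 lam1] b0 s0.
have bs0 : 0 <= b * s by rewrite mulr_ge0// ltW.
have g1 := cubic_growth_excess_lse bs0.
have lbs0 : 0 <= lam * b * s by rewrite -mulrA mulr_ge0.
have g2 := cubic_growth_excess_lse lbs0.
have gi : cubic_growth (@id R) by exact: (@cubic_growthX R 1).
have := le_mean mU U_ge0 iU3 g1
  (cubic_growthD g2 (cubic_growthZ ((1 - lam) * (b * s)) gi)).
rewrite (meanD mU U_ge0 iU3)//; last exact: cubic_growthZ.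
rewrite (meanZ mU U_ge0 iU3)// => h; have {}h := h _.
have c0 : 0 <= b * E id * (q - 1) / (2 * q) * s ^+ 2.
  have q3 := q_ge3.
  by rewrite !mulr_ge0 ?sqr_ge0 ?invr_ge0 ?(ltW b0) ?(ltW m_gt0)//; lra.
rewrite /gap; set c := _ * s ^+ 2 in c0 *.
have -> : lam * b * E id * (q - 1) / (2 * q) * s ^+ 2 = lam * c.
  by rewrite /c; ring.
suff : E (fun u => excess_lse q (b * s * u)) <=
  E (fun u => excess_lse q (lam * b * s * u)) + (1 - lam) * (b * s) * E id.
  by nra.
apply: h => u u0; rewrite -lerBlDl.
have -> : (1 - lam) * (b * s) * u = b * s * u - lam * b * s * u by ring.
apply: excess_lse_lip => //.
by rewrite -!mulrA ler_piMl// !mulr_ge0// ltW.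
Qed.

(* [excess_lse_ge_cubic] is available only where [t * u <= 12^-1]; the complement
   costs at most [K t^3 E[U^3; U > B]], which is negligible for [B] large. *)
Lemma gap_critical_gt0 b : 0 < b ->
  q^-1 * (1 - q^-1) / 2 * b * E (fun u => u ^+ 2) = E id * (q - 1) / (2 * q) ->
  exists2 s, 0 < s <= 1 & 0 < gap b s.
Proof.
move=> b0 crit; have q3 := q_ge3.
set a := q^-1 * (1 - q^-1) / 2 in crit *.
have qV : 0 < q^-1 by rewrite invr_gt0; lra.
have qV1 : q^-1 < 1 by rewrite invf_lt1; lra.
have a0 : 0 < a by rewrite /a !mulr_gt0 ?invr_gt0//; lra.
pose k := (72 * q)^-1; have k0 : 0 < k by rewrite /k invr_gt0; lra.
(* For x = t u > 1/12 this choice gives a x^2 + k x^3 - K x^3 = a x^2 (1 - 12 x) <= 0, so the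
   minorant [gl] below holds beyond the cutoff too. *)
pose K := 12 * a + k; have K0 : 0 < K by rewrite /K; lra.
have M30 : 0 < E (fun u => u ^+ 3).
  by apply: lt_le_trans (mean_cube_ge mU U_ge0 iU3); rewrite exprn_gt0.
have e0 : 0 < k * E (fun u => u ^+ 3) / K by rewrite divr_gt0// mulr_gt0.
have bV : 0 < b^-1 by rewrite invr_gt0.
have [B BA tail] := cubic_tail mU U_ge0 iU3 (Num.max 1 b^-1) e0.
have B1 : 1 <= B by apply: le_trans BA; rewrite le_max lexx.
have Bb : b^-1 <= B by apply: le_trans BA; rewrite le_max lexx orbT.
(* With this t, u <= B implies t u <= 1/12; the floor 1/b on B ensures s = t / b <= 1. *)
pose t := (12 * B)^-1; have t0 : 0 < t by rewrite /t invr_gt0; lra.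
exists (t / b).
  rewrite divr_gt0//= ler_pdivrMr// mul1r /t invf_ple ?posrE//; lra.
have bt : b * (t / b) = t by field; lra.
have gt := cubic_growth_excess_lse (ltW t0).
have gc := cubic_growth_cut B (@cubic_growthX R 3 isT).
have gl := cubic_growthD (cubic_growth_cubic 0 0 (a * t ^+ 2) (k * t ^+ 3))
  (cubic_growthZ (- (K * t ^+ 3)) gc).
have := le_mean mU U_ge0 iU3 gl gt.
rewrite (meanD mU U_ge0 iU3 (cubic_growth_cubic _ _ _ _) (cubic_growthZ _ gc)).
rewrite (mean_cubic mU U_ge0 iU3) (meanZ mU U_ge0 iU3 _ gc) => h.
rewrite /gap bt.
have -> : b * E id * (q - 1) / (2 * q) * (t / b) ^+ 2
  = a * t ^+ 2 * E (fun u => u ^+ 2).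
  rewrite (_ : b * E id * _ / _ = b * (E id * (q - 1) / (2 * q))); last by ring.
  by rewrite -crit; field; lra.
(* Criticality has made the quadratic terms equal; the rest is t^3 (k E[U^3] - K E[U^3; U > B]),
   positive by the choice of B. *)
rewrite subr_gt0; apply: lt_le_trans (h _).
  rewrite !mul0r !add0r -addrA ltrDl.
  rewrite (_ : _ + _ = t ^+ 3 * (k * E (fun u => u ^+ 3)
    - E (fun u => u ^+ 3 * (B < u)%R%:R) * K)); last by ring.
  by rewrite mulr_gt0 ?exprn_gt0// subr_gt0 -ltr_pdivlMr.
move=> u u0; rewrite !mul0r !add0r.
have tu0 : 0 <= t * u by rewrite mulr_ge0// ltW.
have [uB|Bu] := leP u B.
  have tu1 : 0 <= t * u <= 12^-1.
    by rewrite tu0/= /t invfM -mulrA ler_piMr// ler_pdivrMl ?mulr1//; lra.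
  by have := excess_lse_ge_cubic q_gt1 q3 tu1; rewrite -/a -/k !mulr0; lra.
apply: le_trans (excess_lse_ge0 q_gt1 tu0); rewrite mulr1.
have : 1 <= 12 * (t * u).
  rewrite /t invfM mulrA mulrA mulfV// mul1r mulrC ler_pdivlMr ?mul1r; lra.
rewrite (_ : _ + _ = a * (t * u) ^+ 2 - 12 * a * (t * u) ^+ 3); last first.
  by rewrite /K; ring.
set x := t * u in tu0 * => x1.
rewrite (_ : _ - _ = a * x ^+ 2 * (1 - 12 * x)); last by ring.
by rewrite mulr_ge0_le0 ?mulr_ge0 ?sqr_ge0 ?(ltW a0)//; lra.
Qed.

(** The last clause is the source of the jump: small positive s stay excluded even slightly beyond
    [bc]. *)
Lemma gap_transition : exists2 bc, 0 < bc &
  [/\ forall b s, 0 < b < bc -> 0 < s <= 1 -> gap b s < 0,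
      forall b, bc < b -> exists2 s, 0 < s <= 1 & 0 < gap b s
    & exists b1 delta, [/\ bc < b1, 0 < delta &
        forall b s, 0 < b < b1 -> 0 < s < delta -> gap b s < 0]].
Proof.
have q3 := q_ge3.
have M2_gt0 : 0 < E (fun u => u ^+ 2).
  by apply: lt_le_trans (mean_sqr_ge mU U_ge0 iU3); rewrite exprn_gt0.
have M3_gt0 : 0 < E (fun u => u ^+ 3).
  by apply: lt_le_trans (mean_cube_ge mU U_ge0 iU3); rewrite exprn_gt0.
have qV : 0 < q^-1 by rewrite invr_gt0; lra.
have qV1 : q^-1 < 1 by rewrite invf_lt1; lra.
pose A := q^-1 * (1 - q^-1) / 2 * E (fun u => u ^+ 2).
have A0 : 0 < A by rewrite /A !mulr_gt0 ?invr_gt0//; lra.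
pose k := E id * (q - 1) / (2 * q).
have k0 : 0 < k by rewrite /k !mulr_gt0 ?invr_gt0//; lra.
(* The value of b at which the s^2-coefficient of the cubic upper bound vanishes. *)
pose bh := k / A; have bh0 : 0 < bh by rewrite /bh divr_gt0.
have Abh : A * bh = k by rewrite /bh; field; lra.
have gap_lt0 b s : 0 < b -> 0 < s ->
    b ^+ 2 * s * E (fun u => u ^+ 3) < A * (bh - b) -> gap b s < 0.
  move=> b0 s0 h; apply: le_lt_trans (gap_le_cubic b0 (ltW s0)) _.
  rewrite -/k -Abh (_ : _ + _ = b * s ^+ 2 *
    (b ^+ 2 * s * E (fun u => u ^+ 3) - A * (bh - b))); last first.
    by rewrite /A; ring.
  by rewrite pmulr_rlt0 ?mulr_gt0 ?exprn_gt0// subr_lt0.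
have gap_mono b b' s : 0 < b -> b < b' -> 0 < s -> 0 <= gap b s -> 0 < gap b' s.
  move=> b0 bb' s0 g0.
  have lam1 : 1 < b' / b by rewrite ltr_pdivlMr ?mul1r.
  have := gap_superhom lam1 b0 s0.
  by rewrite divfK ?gt_eqF//; apply: le_lt_trans; rewrite mulr_ge0//; lra.
pose S := [set b | 0 < b /\ exists2 s, 0 < s <= 1 & 0 < gap b s].
(* At [bh] some s has positive gap. By [gap_lip], replacing bh by (1 - e) bh costs at most e D,
   which is at most half of that gap. *)
have S_lt_bh : exists2 b, b < bh & S b.
  have crit : q^-1 * (1 - q^-1) / 2 * bh * E (fun u => u ^+ 2) = k.
    by rewrite mulrAC.
  have [s /andP[s0 s1] g0] := gap_critical_gt0 bh0 crit.
  pose D := bh * s * E id; have D0 : 0 < D by do 2 apply: mulr_gt0 => //.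
  pose e := Num.min (1 / 2) (gap bh s / (2 * D)).
  have e0 : 0 < e by rewrite lt_min !divr_gt0// mulr_gt0.
  have e1 : e <= 1 / 2 by rewrite ge_min lexx.
  have eD : e * D <= gap bh s / 2.
    have : e <= gap bh s / (2 * D) by rewrite ge_min lexx orbT.
    rewrite -(ler_pM2r D0) => /le_trans; apply.
    have -> : gap bh s / (2 * D) * D = gap bh s / 2 by field; rewrite gt_eqF.
    by [].
  exists ((1 - e) * bh); first by rewrite gtr_pMl//; lra.
  split; first by rewrite mulr_gt0//; lra.
  exists s; first by rewrite s0.
  have lam01 : 0 <= 1 - e <= 1 by lra.
  apply: lt_le_trans (gap_lip lam01 bh0 s0).
  by rewrite -/D; lra.
(* For b < b0 and s <= 1 one gets b^2 s E[U^3] <= b E[U^3] < A bh / 2 < A (bh - b), so [gap_lt0]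
   applies; hence inf S > 0. *)
pose b0 := Num.min 1 (Num.min (bh / 2) (A * bh / (2 * E (fun u => u ^+ 3)))).
have b0_gt0 : 0 < b0.
  rewrite !lt_min ltr01/= divr_gt0//=.
  by apply: divr_gt0; apply: mulr_gt0.
have S_lb : lbound S b0.
  move=> b [b_gt0 [s /andP[s0 s1]]]; apply: contraTT.
  rewrite -ltNge -leNgt => bb0.
  have b1 : b < 1 by apply: lt_le_trans bb0 _; rewrite ge_min lexx.
  have b2 : b < bh / 2.
    by apply: lt_le_trans bb0 _; rewrite /b0 !ge_min lexx orbT.
  have b3 : b * E (fun u => u ^+ 3) < A * bh / 2.
    have : b < A * bh / (2 * E (fun u => u ^+ 3)).
      by apply: lt_le_trans bb0 _; rewrite /b0 !ge_min lexx !orbT.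
    by rewrite ltr_pdivlMr ?mulr_gt0//; lra.
  apply/ltW/gap_lt0 => //; apply: (@le_lt_trans _ _ (b * E (fun u => u ^+ 3))).
    by rewrite ler_pM2r// expr2 -mulrA ler_piMr ?(ltW b_gt0)// mulr_ile1// ltW.
  by apply: lt_le_trans b3 _; rewrite -mulrA ler_pM2l//; lra.
have S_inf : has_inf S.
  by split; [have [b _ Sb] := S_lt_bh; exists b|exists b0].
have bc_le b : S b -> inf S <= b by apply: ge_inf; exists b0.
exists (inf S).
  by apply: lt_le_trans b0_gt0 _; apply: lb_le_inf => //; case: S_inf.
split.
(* Even a zero gap below inf S would become positive at the midpoint, by strict superhomogeneity,
   and put that midpoint in S. *)
- move=> b s /andP[b_gt0 bc] /andP[s0 s1]; rewrite ltNge; apply/negP => g0.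
  have : S ((b + inf S) / 2).
    split; first lra.
    by exists s; [rewrite s0|apply: gap_mono g0 => //; lra].
  by move/bc_le; lra.
- move=> b bc.
  have [b' [b'0 [s /andP[s0 s1] g0]] b'b] := inf_lt S_inf.1 bc.
  by exists s; [rewrite s0|apply: gap_mono (ltW g0)].
- have [b' b'bh /bc_le bcb'] := S_lt_bh.
  have b'0 : 0 < b'.
    apply: lt_le_trans bcb'; apply: lt_le_trans b0_gt0 _.
    by apply: lb_le_inf => //; case: S_inf.
  (* A point beyond inf S but below bh. The [delta] chosen next is the s at which the cubic term
     could first compensate the quadratic one at b1; smaller b only helps. *)
  pose b1 := (b' + bh) / 2; have b1_gt0 : 0 < b1 by rewrite /b1; lra.
  have b1bh : b1 < bh by rewrite /b1; lra.
  have D0 : 0 < b1 ^+ 2 * E (fun u => u ^+ 3) by rewrite mulr_gt0 ?exprn_gt0.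
  exists b1, (A * (bh - b1) / (b1 ^+ 2 * E (fun u => u ^+ 3))); split.
  + by rewrite /b1; lra.
  + by rewrite divr_gt0// mulr_gt0// subr_gt0.
  move=> b s /andP[b_gt0 bb1] /andP[s0]; rewrite ltr_pdivlMr// => sd.
  apply: gap_lt0 => //.
  apply: (@le_lt_trans _ _ (s * (b1 ^+ 2 * E (fun u => u ^+ 3)))).
    rewrite mulrAC mulrC ler_pM2l// ler_pM2r// lerXn2r ?nnegrE ?ltW//.
  by apply: lt_le_trans sd _; rewrite ler_pM2l// lerB// ltW.
Qed.

End gap.

(** * From the pressure to the gap *)

Section pressure.
Context d (T : measurableType d) (R : realType) (P : probability T R).
Variable W : {RV P >-> R}.
Hypothesis W_ge0 : {ae P, forall x, 0 <= W x}.
Local Notation U := (fun x => `|W x|).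

Lemma measurable_normRV : measurable_fun setT U.
Proof. exact: measurableT_comp. Qed.

(** W is nonnegative only almost surely, while the moment lemmas ask for it pointwise; the absolute
    value bridges the two. *)
Lemma ae_integral_norm (f : R -> R) : measurable_fun setT f ->
  (\int[P]_x (f (W x))%:E = \int[P]_x (f `|W x|)%:E)%E.
Proof.
move=> mf; apply: ae_eq_integral => //.
- by apply/measurable_EFinP; apply: measurableT_comp.
- apply/measurable_EFinP; apply: measurableT_comp => //.
  exact: measurable_normRV.
- by apply: filterS W_ge0 => x Wx _; rewrite ger0_norm.
Qed.

Lemma expectation_mean (f : R -> R) : measurable_fun setT f ->
  fine 'E_P[fun x => f (W x)] = mean P U f.
Proof. by move=> mf; rewrite unlock ae_integral_norm. Qed.

Hypothesis EW3_fin : ('E_P[fun x => (W x ^+ 3)%R] < +oo)%E.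

Lemma integrable_normRV3 : P.-integrable setT (EFin \o (fun x => `|W x| ^+ 3)).
Proof.
have m3 : measurable_fun setT (fun u : R => u ^+ 3) by exact: measurable_funX.
apply/integrableP; split.
  apply/measurable_EFinP; apply: (measurableT_comp m3).
  exact: measurable_normRV.
move: EW3_fin; rewrite unlock (ae_integral_norm m3).
apply: le_lt_trans; rewrite le_eqVlt; apply/orP; left; apply/eqP.
by apply: eq_integral => x _; rewrite gee0_abs// lee_fin exprn_ge0.
Qed.

(** The tangent removed in [excess_lse] contributes b s m / q, which cancels the term 2 s of the
    bracket. The offset is free of s, so both functions have the same maximizers. *)
Lemma pressure_gap (q : nat) (beta s : R) : (3 <= q)%N -> 0 < beta -> 0 <= s ->
  pressure_functional W q beta s = gap P U q%:R (expR beta - 1) s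
    + (ln q%:R + (expR beta - 1) * mean P U id / (2 * q%:R)).
Proof.
move=> q3 beta0 s0; rewrite /pressure_functional.
have q3R : 3 <= q%:R :> R by rewrite (ler_nat R 3 q).
set b := expR beta - 1.
have b0 : 0 < b by rewrite subr_gt0 expR_gt1.
have bs0 : 0 <= b * s by rewrite mulr_ge0// ltW.
have mU := measurable_normRV; have iU3 := integrable_normRV3.
have U_ge0 x : 0 <= U x by [].
have g := cubic_growth_excess_lse q3R bs0.
have gi : cubic_growth (@id R) by exact: (@cubic_growthX R 1).
have gl := cubic_growthD (cubic_growth_cst (ln q%:R : R))
  (cubic_growthZ (b * s / q%:R) gi).
have lseE u : ln (expR (b * u * s) + q%:R - 1)
    = excess_lse q%:R (b * s * u) + (ln q%:R + b * s / q%:R * u).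
  by rewrite /excess_lse (mulrAC b u s) -[in LHS]addrA; ring.
have mlse : measurable_fun setT (fun u => ln (expR (b * u * s) + q%:R - 1)).
  by under eq_fun do rewrite lseE; case: (cubic_growthD g gl).
rewrite (expectation_mean mlse) (expectation_mean (@measurable_id _ _ setT)).
have -> : mean P U (fun u => ln (expR (b * u * s) + q%:R - 1))
    = mean P U (fun u =>
        excess_lse q%:R (b * s * u) + (ln q%:R + b * s / q%:R * u)).
  by apply: eq_Rintegral => x _; rewrite lseE.
rewrite (meanD mU U_ge0 iU3 g gl).
rewrite (meanD mU U_ge0 iU3 (cubic_growth_cst _) (cubic_growthZ _ gi)).
rewrite mean_cst (meanZ mU U_ge0 iU3 _ gi) /gap.
by field; lra.
Qed.

End pressure.

(** * Transfer of the sign of the gap to the maximizers, as functions of beta *)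

Theorem theorem1p24 (d : measure_display) (T : measurableType d) (R : realType)
    (P : probability T R) (W : {RV P >-> R}) (c tau : R) (q : nat)
    (W_ge0 : {ae P, forall x, 0 <= W x})
    (EW_gt0 : (0 < 'E_P[W])%E)
    (c_gt0 : 0 < c) (tau_gt2 : 2 < tau)
    (W_tail : forall w : R, 1 <= w ->
      (P [set x | (w < W x)%R] <= (c * w `^ (- (tau - 1)))%:E)%E)
    (q_ge3 : (3 <= q)%N)
    (EW3_fin : ('E_P[fun x => (W x ^+ 3)%R] < +oo)%E) :
  exists2 beta_c : R, 0 < beta_c &
    forall sstar : R -> R,
      (forall beta, 0 < beta ->
        is_maximizer_on `[0, 1] (pressure_functional W q beta) (sstar beta)) ->
      [/\ makes_jump_at sstar beta_c,
          forall beta, 0 < beta < beta_c -> sstar beta = 0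
        & forall beta, beta_c < beta -> 0 < sstar beta].
Proof.
pose U (x : T) : R := `|W x|.
have mU : measurable_fun setT U := measurable_normRV W.
have iU3 : P.-integrable setT (EFin \o (fun x => U x ^+ 3)).
  exact: integrable_normRV3.
have U_ge0 x : 0 <= U x by exact: normr_ge0.
have q3R : 3 <= q%:R :> R by rewrite (ler_nat R 3 q).
have m_gt0 : 0 < mean P U id.
  rewrite -lte_fin /mean /Rintegral fineK.
    move: EW_gt0; rewrite unlock.
    by rewrite (ae_integral_norm W_ge0 (@measurable_id _ _ setT)).
  apply: integrable_fin_num => //.
  exact: (cubic_growth_integrable mU U_ge0 iU3 (@cubic_growthX R 1 isT)).
have [bc bc0 [neg pos [b1 [delta [bcb1 delta0 small]]]]] :=
  gap_transition mU U_ge0 iU3 q3R m_gt0.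
have lnK1 (x : R) : 0 < x -> expR (ln (1 + x)) - 1 = x.
  by move=> x0; rewrite lnK ?posrE; [ring|lra].
have ltE (beta x : R) : 0 < x -> (beta < ln (1 + x)) = (expR beta - 1 < x).
  by move=> x0; rewrite -ltr_expR -[in RHS](lnK1 x x0) ltrD2r.
have gtE (beta x : R) : 0 < x -> (ln (1 + x) < beta) = (x < expR beta - 1).
  by move=> x0; rewrite -ltr_expR -[in RHS](lnK1 x x0) ltrD2r.
(* Inverse of the increasing substitution b = e^beta - 1. *)
exists (ln (1 + bc)); first by rewrite ln_gt0//; lra.
move=> f fmax.
have beta_c0 : 0 < ln (1 + bc) by rewrite ln_gt0//; lra.
have f01 (beta : R) : 0 < beta -> 0 <= f beta <= 1.
  by move=> /fmax[]; rewrite /= in_itv.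
have gapf (beta s : R) : 0 < beta -> 0 <= s <= 1 ->
    gap P U q%:R (expR beta - 1) s <= gap P U q%:R (expR beta - 1) (f beta).
  move=> beta0 s01; have /andP[f0 _] := f01 _ beta0.
  have [_ /(_ s)] := fmax _ beta0; rewrite /= in_itv/= => /(_ s01).
  rewrite !(pressure_gap W_ge0 EW3_fin q_ge3 beta0)//; last by case/andP: s01.
  by rewrite lerD2r.
have gap0 (b : R) : gap P U q%:R b 0 = 0.
  have -> : gap P U q%:R b 0 = mean P U (fun=> 0) - 0.
    rewrite /gap expr0n !mulr0; congr (_ - _).
    by apply: eq_Rintegral => x _ /=; rewrite mul0r excess_lse0//; lra.
  by rewrite subr0 mean_cst.
have gapf0 (beta : R) : 0 < beta -> 0 <= gap P U q%:R (expR beta - 1) (f beta).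
  by move=> beta0; rewrite -(gap0 (expR beta - 1)) gapf// lexx ler01.
have below (beta : R) : 0 < beta < ln (1 + bc) -> f beta = 0.
  move=> /andP[beta0]; rewrite ltE// => betac; apply/eqP.
  have /andP[f0 f1] := f01 _ beta0; rewrite eq_le f0 andbT leNgt.
  apply/negP => fpos; have := gapf0 _ beta0; rewrite leNgt neg//.
    by rewrite betac subr_gt0 expR_gt1 beta0.
  by rewrite fpos.
have above (beta : R) : ln (1 + bc) < beta -> 0 < f beta.
  move=> betac; have beta0 : 0 < beta by apply: lt_trans betac.
  have /andP[f0 f1] := f01 _ beta0.
  rewrite lt_neqAle f0 andbT; apply/negP => /eqP fE.
  move: betac; rewrite gtE// => /pos[s /andP[s0 s1]].
  rewrite ltNge; apply/negP/negPn.
  by rewrite -[leRHS](gap0 (expR beta - 1)) [in leRHS]fE gapf// s1 ltW.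
(* A maximizer has gap at least that of s = 0, namely 0, and is positive above the threshold;
   [small] then forbids values below [delta] as long as b < b1. *)
have jump : \forall beta \near (ln (1 + bc))^'+, delta <= f beta.
  have lt1 : ln (1 + bc) < ln (1 + b1).
    by rewrite ltr_ln ?posrE ?ltrD2l//; lra.
  near=> beta.
  have betac : ln (1 + bc) < beta by near: beta; exact: nbhs_right_gt.
  have beta1 : beta < ln (1 + b1) by near: beta; exact: nbhs_right_lt.
  have beta0 : 0 < beta by apply: lt_trans betac.
  rewrite leNgt; apply/negP => fd; have := gapf0 _ beta0.
  rewrite leNgt small ?above//.
  by rewrite subr_gt0 expR_gt1 beta0 -ltE//; lra.
split => //; split => //; last by exists delta.
(* Continuity would make the value at the critical point both <= 0, as a limit from the left, and >=
   delta, as a limit from the right. *)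
move=> /= fcont.
have fl : f @ (ln (1 + bc))^'- --> f (ln (1 + bc)).
  exact: cvg_at_left_filter.
have fr : f @ (ln (1 + bc))^'+ --> f (ln (1 + bc)).
  exact: cvg_at_right_filter.
have f0 : f (ln (1 + bc)) <= 0.
  apply: (cvgr_to_le fl).
  near=> beta; rewrite /= below//; apply/andP; split.
    by near: beta; exact: nbhs_left_gt.
  by near: beta; exact: nbhs_left_lt.
have jump_le : delta <= f (ln (1 + bc)) by apply: (cvgr_to_ge fr).
by move: (le_trans jump_le f0); rewrite leNgt delta0.
Unshelve. all: by end_near.
Qed.
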